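(* Let $\Gamma$ be a hyperbolic group with Gromov boundary $\partial\Gamma$, and let $\rho_\partial\in \mathrm{Hom}(\Gamma,\mathrm{Homeo}(\partial\Gamma))$ be the standard boundary action. For any neighborhood $\mathcal{U}$ of the identity in the space of continuous self-maps of $\partial\Gamma$, there exists a neighborhood $\mathcal{V}$ of $\rho_\partial$ in $\mathrm{Hom}(\Gamma,\mathrm{Homeo}(\partial\Gamma))$ such that every $\rho\in\mathcal{V}$ is an extension of $\rho_\partial$ via a semi-conjugacy in $\mathcal{U}$; that is, there is a continuous surjective map $h\colon\partial\Gamma\to\partial\Gamma$ with $h\in\mathcal{U}$ and $h\circ\rho(\gamma)=\rho_\partial(\gamma)\circ h$ for all $\gamma\in\Gamma$.
   Context: The standard boundary action of a hyperbolic group $\Gamma$ is the action by homeomorphisms on its Gromov boundary $\partial\Gamma$ (a compact metrizable space) extending the action of $\Gamma$ on itself by left multiplication. The space of continuous self-maps of $\partial\Gamma$ and the group $\mathrm{Homeo}(\partial\Gamma)$ carry the $C^0$ (uniform, equivalently compact-open) topology, and $\mathrm{Hom}(\Gamma,\mathrm{Homeo}(\partial\Gamma))$ carries the topology of pointwise convergence on $\Gamma$ (equivalently, convergence on a finite generating set). For a space $X$ and $\rho_0,\rho\in\mathrm{Hom}(\Gamma,\mathrm{Homeo}(X))$, $\rho$ is an extension of $\rho_0$ if there is a continuous surjective map $h\colon X\to X$ (called a semi-conjugacy) with $h\circ\rho(\gamma)=\rho_0(\gamma)\circ h$ for all $\gamma\in\Gamma$. *)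

(* Defs.v *)
(* MathComp, with the topology of MathComp-Analysis *)
From HB Require Import structures.
From mathcomp Require Import all_boot all_order all_algebra lra.
From mathcomp Require Import boolp classical_sets functions topology.
Set Implicit Arguments.
Unset Strict Implicit.
Unset Printing Implicit Defensive.
Import Order.TTheory GRing.Theory Num.Theory.
Local Open Scope classical_set_scope.
Local Open Scope ring_scope.

(* {compact-open, X -> Y} becomes the topology of X -> Y, and continuousType X Y
   carries the induced one. For X compact metrizable this is the C^0 topology. *)
Export ArrowAsCompactOpen.

(** * Homeomorphism groups and spaces of actions *)

Record homeo (X : topologicalType) := Homeo {
  homeo_fun :> X -> X;
  homeo_inv : X -> X;
  homeo_funK : cancel homeo_fun homeo_inv;
  homeo_invK : cancel homeo_inv homeo_fun;
  homeo_cts : continuous homeo_fun;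
  homeo_inv_cts : continuous homeo_inv }.

Lemma homeoP (X : topologicalType) (f g : homeo X) : f =1 g -> f = g.
Proof.
case: f => f f' fK f'K fc f'c; case: g => g g' gK g'K gc g'c /= fg.
have {}fg : f = g by apply/funext.
subst g; have f'g' : f' = g' by apply/funext => x; apply: (can_inj fK); rewrite f'K g'K.
by subst g'; congr Homeo; exact: Prop_irrelevance.
Qed.

HB.instance Definition _ (X : topologicalType) := gen_eqMixin (homeo X).
HB.instance Definition _ (X : topologicalType) := gen_choiceMixin (homeo X).

Section HomeoGroup.
Variable X : topologicalType.
Implicit Types f g h : homeo X.

Definition homeo_one : homeo X.
Proof. by exists idfun idfun => // x; exact: cvg_id. Defined.

Definition homeo_opp f : homeo X :=
  Homeo (homeo_invK f) (homeo_funK f) (homeo_inv_cts (h := f)) (homeo_cts (h := f)).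

Definition homeo_mul f g : homeo X.
Proof.
exists (f \o g) (homeo_inv g \o homeo_inv f).
- exact: can_comp (homeo_funK f) (homeo_funK g).
- exact: can_comp (homeo_invK g) (homeo_invK f).
- by move=> x; apply: continuous_comp; exact: homeo_cts.
- by move=> x; apply: continuous_comp; exact: homeo_inv_cts.
Defined.

Fact homeo_mulA : associative homeo_mul.
Proof. by move=> f g h; apply: homeoP. Qed.
Fact homeo_mul1 : left_id homeo_one homeo_mul.
Proof. by move=> f; apply: homeoP. Qed.
Fact homeo_1mul : right_id homeo_one homeo_mul.
Proof. by move=> f; apply: homeoP. Qed.
Fact homeo_mulV : left_inverse homeo_one homeo_opp homeo_mul.
Proof. by move=> f; apply: homeoP => x /=; rewrite homeo_funK. Qed.
Fact homeo_Vmul : right_inverse homeo_one homeo_opp homeo_mul.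
Proof. by move=> f; apply: homeoP => x /=; rewrite homeo_invK. Qed.

HB.instance Definition _ := isGroup.Build (homeo X)
  homeo_mulA homeo_mul1 homeo_1mul homeo_mulV homeo_Vmul.

End HomeoGroup.

HB.instance Definition _ (X : topologicalType) := Topological.copy (homeo X)
  (initial_topology (@homeo_fun X : homeo X -> {compact-open, X -> X})).

(* Hom(G, Homeo(X)) with the topology of pointwise convergence on G. *)
Definition Hom_homeo (G : groupType) (X : topologicalType) : Type :=
  {multiplicative G -> homeo X}.

HB.instance Definition _ (G : groupType) (X : topologicalType) :=
  gen_eqMixin (Hom_homeo G X).
HB.instance Definition _ (G : groupType) (X : topologicalType) :=
  gen_choiceMixin (Hom_homeo G X).
HB.instance Definition _ (G : groupType) (X : topologicalType) :=
  Topological.copy (Hom_homeo G X)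
    (initial_topology ((fun rho g => rho g) : Hom_homeo G X -> {ptws G -> homeo X})).

Definition semi_conjugacy (G : groupType) (X : topologicalType)
    (rho0 rho : Hom_homeo G X) (h : X -> X) : Prop :=
  [/\ continuous h, forall y, exists x, h x = y &
      forall g : G, h \o rho g = rho0 g \o h].

(** * Word metrics and hyperbolic groups *)

Definition word_of (G : groupType) (S : seq G) (n : nat) (g : G) : Prop :=
  exists w : seq G, [/\ size w = n,
    all (fun s => (s \in S) || ((s^-1)%g \in S)) w & g = (\prod_(s <- w) s)%g].

Record genset (G : groupType) := Genset {
  gens :> seq G;
  gensP : forall g : G, exists n, word_of gens n g }.

Section WordMetric.
Variables (G : groupType) (S : genset G).
Implicit Types (g h o : G) (x y : nat -> G).

Fact word_length_subproof g : exists n, `[< word_of S n g >].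
Proof. by have [n Sn] := gensP S g; exists n; exact/asboolP. Qed.

Definition word_length g : nat := ex_minn (word_length_subproof g).

Definition word_dist g h : nat := word_length (g^-1 * h)%g.

(* Gromov product based at o; its values are half-integers, so rationals do. *)
Definition gromov_prod o g h : rat :=
  ((word_dist g o)%:R + (word_dist h o)%:R - (word_dist g h)%:R) / 2.

(* Gromov's condition at every base point; it holds for S iff it holds for every
   finite generating set. *)
Definition hyperbolic : Prop :=
  exists delta : rat, forall g h k o : G,
    Num.min (gromov_prod o g h) (gromov_prod o h k) - delta
      <= gromov_prod o g k.

(* liminf_(i, j) (x_i | y_j)_1 >= r. The products lie in a discrete set, so this
   is the same as being >= r for all large i and j. *)
Definition gprod_eventually_ge x y (r : rat) : Prop :=
  exists N, forall i j, (N <= i)%N -> (N <= j)%N ->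
    r <= gromov_prod 1%g (x i) (y j).

(* lim_(i, j) (x_i | y_j)_1 = +oo *)
Definition gprod_cvgy x y : Prop := forall r, gprod_eventually_ge x y r.

Definition cvg_infinity x : Prop := gprod_cvgy x x.

Definition boundary_class x : set (nat -> G) :=
  [set y | cvg_infinity y /\ gprod_cvgy x y].

(* The points are the equivalence classes themselves; when S is hyperbolic,
   gprod_cvgy is an equivalence relation on sequences converging to infinity. *)
Record boundary := Boundary {
  bclass :> set (nat -> G);
  bclassP : exists2 x, cvg_infinity x & bclass = boundary_class x }.

HB.instance Definition _ := gen_eqMixin boundary.
HB.instance Definition _ := gen_choiceMixin boundary.

(* {eta | (xi | eta) >= r}, where (xi | eta) is the sup over representatives of
   liminf (x_i | y_j) *)
Definition boundary_nbhs (xi : boundary) (r : rat) : set boundary :=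
  [set eta : boundary |
    exists x y, [/\ bclass xi x, bclass eta y & gprod_eventually_ge x y r]].

Definition boundary_open : set_system boundary :=
  [set U | forall xi, U xi -> exists r, boundary_nbhs xi r `<=` U].

Lemma gprod_eventually_le x y r s :
  s <= r -> gprod_eventually_ge x y r -> gprod_eventually_ge x y s.
Proof. by move=> sr [N Nr]; exists N => i j Ni /(Nr _ _ Ni)/(le_trans sr). Qed.

Fact boundary_openT : boundary_open setT.
Proof. by move=> xi _; exists 0. Qed.

Fact boundary_openI : setI_closed boundary_open.
Proof.
move=> A B oA oB xi [/oA[r rA] /oB[s sB]]; exists (Num.max r s).
move=> eta [x [y [xix etay xy]]].
by split; [apply: rA | apply: sB]; exists x, y; split=> //;
  apply: gprod_eventually_le xy; rewrite le_max lexx ?orbT.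
Qed.

Fact boundary_open_bigU (I : Type) (f : I -> set boundary) :
  (forall i, boundary_open (f i)) -> boundary_open (\bigcup_i f i).
Proof.
move=> of_ xi [i _ /of_[r rf]]; exists r => eta /rf; by exists i.
Qed.

HB.instance Definition _ := isOpenTopological.Build boundary
  boundary_openT boundary_openI boundary_open_bigU.

(** * The boundary action *)

Lemma word_lengthP g : word_of S (word_length g) g.
Proof. by rewrite /word_length; case: ex_minnP => n /asboolP. Qed.

Lemma word_length_min n g : word_of S n g -> (word_length g <= n)%N.
Proof. by rewrite /word_length; case: ex_minnP => m _ + /asboolP; exact. Qed.

Lemma word_lengthM g h :
  (word_length (g * h)%g <= word_length g + word_length h)%N.
Proof.
have [v [sv av gv]] := word_lengthP g; have [w [sw aw hw]] := word_lengthP h.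
apply: word_length_min; exists (v ++ w).
by rewrite size_cat sv sw all_cat av aw big_cat /= -gv -hw.
Qed.

Lemma gromov_prod_mul o g h :
  gromov_prod 1%g g h - (word_length o)%:R <= gromov_prod 1%g (o * g)%g (o * h)%g.
Proof.
rewrite /gromov_prod /word_dist !mulg1.
have -> : ((o * g)^-1 * (o * h) = g^-1 * h)%g by rewrite invgM -mulgA mulKg.
have le k : (word_length (k^-1)%g : nat)%:R - (word_length o)%:R
    <= (word_length (o * k)^-1%g)%:R :> rat.
  rewrite lerBlDr -natrD ler_nat.
  by have := word_lengthM ((o * k)^-1)%g o; rewrite invgM -mulgA mulVg mulg1.
by have := le g; have := le h; lra.
Qed.

Definition shift_seq g x : nat -> G := fun i => (g * x i)%g.

Lemma gprod_eventually_shift g x y r :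
  gprod_eventually_ge x y (r + (word_length g)%:R) ->
  gprod_eventually_ge (shift_seq g x) (shift_seq g y) r.
Proof.
move=> [N Nr]; exists N => i j Ni Nj; apply: le_trans (gromov_prod_mul _ _ _).
by rewrite lerBrDr; exact: Nr.
Qed.

Lemma gprod_cvgy_shift g x y :
  gprod_cvgy x y -> gprod_cvgy (shift_seq g x) (shift_seq g y).
Proof. by move=> xy r; exact: gprod_eventually_shift. Qed.

Lemma shift_seqM g h x : shift_seq g (shift_seq h x) = shift_seq (g * h)%g x.
Proof. by apply/funext => i; rewrite /shift_seq mulgA. Qed.

Lemma shift_seq1 x : shift_seq 1%g x = x.
Proof. by apply/funext => i; rewrite /shift_seq mul1g. Qed.

Fact shift_boundary_subproof g (xi : boundary) :
  exists2 x, cvg_infinity x & shift_seq g @` bclass xi = boundary_class x.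
Proof.
have [x cx xiE] := bclassP xi; exists (shift_seq g x).
  exact: gprod_cvgy_shift.
rewrite xiE; apply/seteqP; split=> [_ [y [cy xy] <-]|z [cz xz]].
  by split; exact: gprod_cvgy_shift.
exists (shift_seq g^-1%g z); last by rewrite shift_seqM mulgV shift_seq1.
split; first exact: gprod_cvgy_shift.
by have := gprod_cvgy_shift g^-1%g xz; rewrite shift_seqM mulVg shift_seq1.
Qed.

(* g . [x_n] = [g x_n] *)
Definition shift_boundary g (xi : boundary) : boundary :=
  Boundary (shift_boundary_subproof g xi).

Lemma boundaryP (xi eta : boundary) : bclass xi = bclass eta -> xi = eta.
Proof.
case: xi eta => [A PA] [B PB] /= AB; subst B.
by congr Boundary; exact: Prop_irrelevance.
Qed.

Lemma shift_boundaryM g h xi :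
  shift_boundary g (shift_boundary h xi) = shift_boundary (g * h)%g xi.
Proof.
apply: boundaryP; rewrite /= image_comp.
by apply: eq_imagel => x _ /=; rewrite shift_seqM.
Qed.

Lemma shift_boundary1 xi : shift_boundary 1%g xi = xi.
Proof.
apply: boundaryP => /=; rewrite -[RHS]image_id.
by apply: eq_imagel => x _; rewrite shift_seq1.
Qed.

Lemma shift_boundary_continuous g : continuous (shift_boundary g).
Proof.
apply/continuousP => U oU; change (boundary_open (shift_boundary g @^-1` U)).
move=> xi /= /oU[r rU].
exists (r + (word_length g)%:R) => eta [x [y [xix etay xy]]].
apply: rU; exists (shift_seq g x), (shift_seq g y).
by split; [exists x | exists y | exact: gprod_eventually_shift].
Qed.

Definition boundary_homeo g : homeo boundary.
Proof.
exists (shift_boundary g) (shift_boundary g^-1%g).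
- by move=> xi; rewrite shift_boundaryM mulVg shift_boundary1.
- by move=> xi; rewrite shift_boundaryM mulgV shift_boundary1.
- exact: shift_boundary_continuous.
- exact: shift_boundary_continuous.
Defined.

Fact boundary_homeoM : {morph boundary_homeo : g h / (g * h)%g}.
Proof. by move=> g h; apply: homeoP => xi /=; rewrite shift_boundaryM. Qed.

HB.instance Definition _ :=
  isMultiplicative.Build G (homeo boundary) boundary_homeo boundary_homeoM.

Definition boundary_action : Hom_homeo G boundary := boundary_homeo.

End WordMetric.

(* Main.v *)
Require Import Defs.
From HB Require Import structures.
From mathcomp Require Import all_boot all_order all_algebra.
From mathcomp Require Import boolp classical_sets functions topology.
From mathcomp Require Import lra zify.
Set Implicit Arguments.
Unset Strict Implicit.
Unset Printing Implicit Defensive.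
Import Order.TTheory GRing.Theory Num.Theory.
Local Open Scope classical_set_scope.
Local Open Scope ring_scope.

(** The theorem is an instance of the principle that an expansive action with
the shadowing property is topologically stable.

If [h] is a semi-conjugacy close to the identity, then [rho g xi] stays close to
[g (h xi)] for every [g]; so [h xi] has to be a point whose orbit shadows
the [rho]-orbit of [xi]. Such a point is unique because the boundary action is
expansive ([boundary_expansive]): for [p] far out on a ray to [eta], the map
[p^-1] blows a small neighbourhood of [eta] up to a large set, so that rough
closeness of [p^-1 zeta] to [p^-1 eta] forces [zeta] to be very close to [eta].
Uniqueness makes [h] equivariant, and the same estimate makes it continuous.

Existence is a local-to-global principle in the Cayley graph. Put
[psi g = g (rho g^-1 xi)]. When [rho] is close to the boundary action on a large
ball, [psi g] and [psi g'] look the same from [g] as soon as [g] and [g'] are at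
bounded distance; so [psi] is a coherent choice, at every vertex, of a direction
to infinity. Replacing [psi g] by a vertex [v g] far out in that direction gives
a field of targets. Following the field with steps of a fixed large length [L]
gives a path without backtracking, so it converges to a boundary point, and this
point lies in the direction [v g] seen from every vertex [g], near the path or not
([coherent_field_target]). The reason is that errors contract: walking a step of
length [L] back from a target turns a rough agreement with [v] into an agreement
up to [L] minus a bounded constant ([target_gain]).

Surjectivity comes from expansivity again and needs no case distinction between
elementary and non-elementary groups: given [eta] and elements [p] expanding
smaller and smaller neighbourhoods of [eta], the points [rho p^-1 (p eta)] have
images under [h] converging to [eta], and any of their cluster points is mapped to
[eta]. *)

(** * Word metric and Gromov products *)

Lemma exists_natr_ge (r : rat) :
  exists n : nat, forall m : nat, (n <= m)%N -> r <= m%:R.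
Proof.
exists (Num.bound `|r|) => m nm; apply: le_trans (ler_norm _) _; apply: ltW.
by apply: lt_le_trans (archi_boundP (normr_ge0 _)) _; rewrite ler_nat.
Qed.

Section WordMetricFacts.
Variables (G : groupType) (S : genset G).
Implicit Types (g h k o p q : G).
Notation wd := (word_dist S).
Notation gp := (gromov_prod S).

Lemma word_length1 : word_length S 1%g = 0%N.
Proof.
apply/eqP; rewrite -leqn0; apply: word_length_min.
by exists [::]; rewrite big_nil.
Qed.

Lemma word_lengthV g : word_length S g^-1%g = word_length S g.
Proof.
suff le h : (word_length S h^-1%g <= word_length S h)%N.
  by apply/eqP; rewrite eqn_leq le -{1}[g]invgK le.
have [w [sw aw hw]] := word_lengthP S h; apply: word_length_min.
exists (rev [seq s^-1%g | s <- w]); split; first by rewrite size_rev size_map.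
  rewrite all_rev all_map; apply: sub_all aw => s /=.
  by rewrite invgK orbC.
rewrite {}hw; elim: w {sw aw} => [|s w IH]; first by rewrite !big_nil invg1.
by rewrite map_cons rev_cons -cats1 big_cat big_cons invgM IH /= big_seq1.
Qed.

Lemma word_dist_sym g h : wd g h = wd h g.
Proof. by rewrite /word_dist -word_lengthV invgM invgK. Qed.

Lemma word_dist_self g : wd g g = 0%N.
Proof. by rewrite /word_dist mulVg word_length1. Qed.

Lemma word_dist_triangle g h k : (wd g k <= wd g h + wd h k)%N.
Proof.
rewrite /word_dist; have -> : (g^-1 * k = (g^-1 * h) * (h^-1 * k))%g.
  by rewrite mulgA mulgK.
exact: word_lengthM.
Qed.

Lemma word_dist_mul o g h : wd (o * g)%g (o * h)%g = wd g h.
Proof. by rewrite /word_dist invgM -mulgA mulKg. Qed.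

(** Cutting a shortest word gives a geodesic point at any prescribed distance. *)
Lemma word_dist_geodesic g h n : (n <= wd g h)%N ->
  exists p, wd g p = n /\ (wd p h = wd g h - n)%N.
Proof.
move=> le_n; have [w [sw aw hw]] := word_lengthP S (g^-1 * h)%g.
pose p := (g * \prod_(s <- take n w) s)%g.
have hE : h = (p * \prod_(s <- drop n w) s)%g.
  by rewrite /p -mulgA -big_cat /= cat_take_drop -hw mulVKg.
have gp_le : (wd g p <= n)%N.
  rewrite /word_dist /p mulKg; apply: word_length_min; exists (take n w).
  rewrite size_takel ?sw //; split=> //.
  by move: aw; rewrite -{1}(cat_take_drop n w) all_cat => /andP[].
have ph_le : (wd p h <= wd g h - n)%N.
  rewrite {1}/word_dist {1}hE mulKg; apply: word_length_min; exists (drop n w).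
  rewrite size_drop sw; split=> //.
  by move: aw; rewrite -{1}(cat_take_drop n w) all_cat => /andP[].
by exists p; have := word_dist_triangle g p h; lia.
Qed.

Lemma gromov_prod_sym o g h : gp o g h = gp o h g.
Proof. by rewrite /gromov_prod (word_dist_sym g h); lra. Qed.

Lemma gromov_prod_translate a o g h :
  gp (a * o)%g (a * g)%g (a * h)%g = gp o g h.
Proof. by rewrite /gromov_prod !word_dist_mul. Qed.

Lemma word_dist_triangleR g h k :
  (wd g k)%:R <= (wd g h)%:R + (wd h k)%:R :> rat.
Proof. by rewrite -natrD ler_nat word_dist_triangle. Qed.

Lemma gromov_prod_le o g h : gp o g h <= (wd o g)%:R.
Proof.
have := word_dist_triangleR h g o.
by rewrite /gromov_prod (word_dist_sym g o) (word_dist_sym g h); lra.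
Qed.

Lemma gromov_prod_swap o g h : gp o g h = (wd o g)%:R - gp g o h.
Proof.
by rewrite /gromov_prod (word_dist_sym o g) (word_dist_sym h g)
  (word_dist_sym h o); lra.
Qed.

Lemma gromov_prod_self o g : gp o g g = (wd o g)%:R.
Proof. by rewrite /gromov_prod word_dist_self (word_dist_sym g o); lra. Qed.

End WordMetricFacts.

(** * Shadowing in the Cayley graph *)

Section Shadowing.
Variables (G : groupType) (S : genset G) (d : rat).
Implicit Types (g h k o p q a t : G).
Notation wd := (word_dist S).
Notation gp := (gromov_prod S).

Definition delta_hyperbolic := 0 < d /\ forall g h k o,
  Num.min (gp o g h) (gp o h k) - d <= gp o g k.

Hypothesis hypd : delta_hyperbolic.

Lemma gromov_prod_trans o h g k r :
  r <= gp o g h -> r <= gp o h k -> r - d <= gp o g k.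
Proof.
move=> gh hk; have [_ /(_ g h k o)] := hypd; apply: le_trans.
by rewrite lerD2r le_min gh.
Qed.

(** The four-point condition read contrapositively, to transfer divergence: what
    is opposite to [k] seen from [o] is opposite to whatever lies near [k]. *)
Lemma gromov_prod_bound o g h k c :
  gp o g k <= c -> c + d < gp o h k -> gp o g h <= c + d.
Proof.
move=> gk hk; rewrite leNgt; apply/negP => gh.
have [_ /(_ g h k o)] := hypd.
by case: (leP (gp o g h) (gp o h k)); lra.
Qed.

(** [v g] stands for a boundary point seen from [g]; the field [v] is coherent
    when neighbouring vertices see each other's targets in the same direction. *)
Variables (L : nat) (v : G -> G).
Hypothesis L_large : 13 * d <= L%:R.
Hypothesis v_far : forall g, (L <= wd g (v g))%N.
Hypothesis v_coherent : forall g h, (wd g h <= L.*2)%N ->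
  L%:R <= gp h (v g) (v h).

(** The contraction step. Suppose that from [q] the point [t] is roughly in the
    direction [v q], while [p] is behind. Then [q] lies roughly between [p] and
    both [t] and [v q], so [p] sees [t] and [v q] together at least up to [q];
    coherence replaces [v q] by [v p]. The conclusion does not depend on how well
    [t] and [v q] agree, which is what allows iteration without loss. *)
Lemma target_gain t p q c : (L <= wd p q <= L.*2)%N ->
  gp q p t <= c -> c + d < gp q t (v q) -> 0 <= c ->
  L%:R - c - 3 * d <= gp p t (v p).
Proof.
move=> /andP[Lpq pqL] ptc tvq c0; have [d0 _] := hypd; have Ld := L_large.
have pvq : gp q p (v q) <= c + d.
  by apply: gromov_prod_bound ptc _; rewrite gromov_prod_sym.
have Lr : L%:R <= (wd p q)%:R :> rat by rewrite ler_nat.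
have tq : L%:R - c - d <= gp p t q.
  by rewrite gromov_prod_sym gromov_prod_swap; lra.
have qvq : L%:R - c - d <= gp p q (v q) by rewrite gromov_prod_swap; lra.
have tvqp : L%:R - c - 2 * d <= gp p t (v q).
  by have := gromov_prod_trans tq qvq; lra.
have vv : L%:R - c - 2 * d <= gp p (v q) (v p).
  by have := v_coherent (g := q) (h := p); rewrite word_dist_sym pqL => /(_ isT); lra.
by have := gromov_prod_trans tvqp vv; lra.
Qed.

(** Iterates [target_gain] along a geodesic from [a] back to [h]. A step has
    length [L] except for the one ending at [a], whose length lies between [L] and
    [2 L]; this is why coherence is required up to distance [2 L]. The turn at [a]
    is at most [4 d]; at the other vertices of the geodesic it is at most [d]. *)
Lemma target_walk t a h :
  5 * d < gp a t (v a) -> gp a h t <= 4 * d -> (L <= wd h a)%N ->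
  L%:R - 7 * d <= gp h t (v h).
Proof.
have [d0 _] := hypd; have Ld := L_large.
move=> tva; have [n] := ubnP (wd h a); elim: n h => // n IH h.
move=> lt_n ht Lha; have [le2L|gt2L] := leqP (wd h a) L.*2.
  have /target_gain : (L <= wd h a <= L.*2)%N by rewrite Lha.
  by move=> /(_ t _ ht); lra.
have [q [hq qa]] := word_dist_geodesic Lha.
have haq : (wd h a)%:R = L%:R + (wd q a)%:R :> rat.
  by rewrite qa -natrD; congr (_%:R); lia.
have L0 : (0 < L)%N by have : 0 < L%:R :> rat; [lra|rewrite ltr0n].
have qt : gp a q t <= 4 * d.
  have := word_dist_triangleR S h q t.
  by move: ht; rewrite /gromov_prod hq; lra.
have Lqa : (L <= wd q a)%N by lia.
have tvq : L%:R - 7 * d <= gp q t (v q) by apply: IH => //; lia.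
have hta : gp q h a = 0.
  by rewrite /gromov_prod (word_dist_sym S a q) hq; lra.
have htq : gp q h t <= d.
  have /gromov_prod_bound : gp q h a <= 0 by rewrite hta.
  have LqaR : L%:R <= (wd q a)%:R :> rat by rewrite ler_nat.
  have ta : d < gp q t a.
    by rewrite (gromov_prod_sym _ _ t) gromov_prod_swap; lra.
  by move=> /(_ t); rewrite add0r => ->.
have /target_gain : (L <= wd h q <= L.*2)%N by rewrite hq; lia.
by move=> /(_ t _ htq); lra.
Qed.

(** The path that follows the field with steps of length [L]. *)
Lemma flow_exists :
  { f : nat -> G | f 0%N = 1%g /\ forall n,
      wd (f n) (f n.+1) = L /\ gp (f n.+1) (f n) (v (f n)) = 0 }.
Proof.
have step g : { p | wd g p = L /\ gp p g (v g) = 0 }.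
  apply: cid; have [p [gp pv]] := word_dist_geodesic (v_far g); exists p.
  split=> //; rewrite /gromov_prod gp (word_dist_sym S (v g)) pv.
  by rewrite natrB ?v_far //; lra.
exists (fun n => iter n (fun g => sval (step g)) 1%g); split=> // n.
by rewrite iterS; case: (step _).
Qed.

Section Flow.
Variable f : nat -> G.
Hypothesis f0 : f 0%N = 1%g.
Hypothesis f_step : forall n,
  wd (f n) (f n.+1) = L /\ gp (f n.+1) (f n) (v (f n)) = 0.

(** The path goes straight: seen from [f n.+1], the vertex [f n] is opposite to
    [v (f n)], hence to [v (f n.+1)] by coherence, hence to any point [f M] in
    that direction. *)
Let f_turn M n : L%:R - 5 * d <= gp (f n.+1) (f M) (v (f n.+1)) ->
  gp (f n.+1) (f n) (f M) <= 2 * d.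
Proof.
move=> tgt; have [d0 _] := hypd; have Ld := L_large.
have [wdn turn0] := f_step n.
have fnv : gp (f n.+1) (f n) (v (f n.+1)) <= d.
  rewrite -[X in _ <= X]add0r; apply: (@gromov_prod_bound _ _ _ (v (f n))).
    by rewrite turn0.
  have := @v_coherent (f n) (f n.+1); rewrite wdn -addnn leq_addr => /(_ isT).
  by rewrite (gromov_prod_sym _ _ (v (f n))); lra.
have -> : 2 * d = d + d by lra.
by apply: gromov_prod_bound fnv _; lra.
Qed.

(** Later points of the path lie in the direction of the field, by descending
    induction on [n] starting from [M - 1], where it holds by construction. *)
Lemma flow_target M n : (n < M)%N ->
  L%:R - 5 * d <= gp (f n) (f M) (v (f n)).
Proof.
have [d0 _] := hypd; have Ld := L_large.
move=> ltnM; rewrite -(subKn (ltnW ltnM)).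
have : (0 < M - n)%N by rewrite subn_gt0.
move: (M - n)%N (leq_subr n M) => {ltnM}{}n.
elim: n => // -[_ M0 _|n IH leM _].
  have [] := f_step (M - 1); rewrite subn1 prednK // => wdM turn0.
  by rewrite gromov_prod_swap wdM turn0; lra.
have := IH (ltnW leM) isT.
have -> : (M - n.+1 = (M - n.+2).+1)%N by lia.
move: (M - n.+2)%N => m tgt; have [wdm _] := f_step m.
have turn := f_turn tgt.
have /target_gain : (L <= wd (f m) (f m.+1) <= L.*2)%N.
  by rewrite wdm leqnn -addnn leq_addr.
by move=> /(_ (f M) _ turn); lra.
Qed.

(** Local-to-global: by induction on [n], the segment from [f n] to [f n.+1]
    points away from all earlier points of the path, so the turn at [f n.+1]
    between the previous vertex and [f M] is, up to [d], the turn between [f k]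
    and [f M]. *)
Lemma flow_turn (k n M : nat) : (k < n)%N -> (n < M)%N ->
  gp (f n) (f k) (f M) <= 3 * d.
Proof.
have [d0 _] := hypd; have Ld := L_large.
elim: n M => // n IH M; rewrite ltnS leq_eqVlt => kn nM.
have turn : gp (f n.+1) (f n) (f M) <= 2 * d by exact/f_turn/flow_target.
case/orP: kn => [/eqP -> | kn]; first by lra.
have := IH n.+1 kn (ltnSn n); have [wdn _] := f_step n => IHn.
rewrite gromov_prod_sym; have -> : 3 * d = 2 * d + d by lra.
rewrite gromov_prod_sym in turn; apply: gromov_prod_bound turn _.
rewrite gromov_prod_sym gromov_prod_swap word_dist_sym wdn.
by rewrite (gromov_prod_sym _ _ (f n.+1)); lra.
Qed.

Lemma flow_far n : (n <= wd 1%g (f n))%N.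
Proof.
have [d0 _] := hypd; have Ld := L_large.
case: n => // n; elim: n => [|n IH].
  have [+ _] := f_step 0; rewrite f0 => ->.
  by have : 0 < L%:R :> rat; [lra|rewrite ltr0n].
apply: leq_ltn_trans IH _.
suff : (wd 1%g (f n.+1))%:R < (wd 1%g (f n.+2))%:R :> rat by rewrite ltr_nat.
have := @flow_turn 0 n.+1 n.+2 isT (ltnSn _); have [+ _] := f_step n.+1.
rewrite f0 /gromov_prod (word_dist_sym S (f n.+2)) => ->.
by lra.
Qed.

Lemma flow_cvg_infinity : cvg_infinity S f.
Proof.
have [d0 _] := hypd; have Ld := L_large.
move=> r; have [N /(_ N (leqnn N)) rN] := exists_natr_ge (r + 4 * d).
exists N.+1 => i j Ni Nj.
wlog ij : i j Ni Nj / (i <= j)%N => [wl|].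
  case: (leqP i j) => [|/ltnW]; first exact: wl.
  by rewrite gromov_prod_sym; exact: wl.
have iN : N%:R <= (wd 1%g (f i))%:R :> rat.
  by rewrite ler_nat (leq_trans (ltnW Ni)) ?flow_far.
move: ij; rewrite leq_eqVlt => /orP[/eqP <-|ij].
  by rewrite gromov_prod_self; lra.
have i0 : (0 < i)%N by apply: leq_trans Ni.
by have := flow_turn i0 ij; rewrite [gp 1%g _ _]gromov_prod_swap f0; lra.
Qed.

(** For [n] large, [f n] is far from [h], so the turn of the path at [f n]
    seen from [1] is also a turn seen from [h]; then walk back from [f n] to [h]. *)
Lemma flow_shadows h :
  exists N, forall M, (N <= M)%N -> L%:R - 7 * d <= gp h (f M) (v h).
Proof.
have [d0 _] := hypd; have Ld := L_large.
pose n := (wd 1%g h + wd 1%g h + L).+1; exists n.+1 => M nM.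
have far : (wd h (f n))%:R >= (wd 1%g h)%:R + L%:R :> rat.
  rewrite -natrD ler_nat; have := flow_far n.
  by have := word_dist_triangle S 1%g h (f n); rewrite /n; lia.
have d1h : 0 <= (wd 1%g h)%:R :> rat by [].
apply: (@target_walk _ (f n)).
- by have := flow_target nM; lra.
- have -> : 4 * d = 3 * d + d by lra.
  have turn := @flow_turn 0 n M isT nM.
  rewrite f0 gromov_prod_sym in turn.
  rewrite gromov_prod_sym; apply: gromov_prod_bound turn _.
  rewrite gromov_prod_swap (word_dist_sym S (f n)).
  have := gromov_prod_le S h 1%g (f n).
  by rewrite gromov_prod_sym (word_dist_sym S h); lra.
- suff : L%:R <= (wd h (f n))%:R :> rat by rewrite ler_nat.
  by lra.
Qed.
End Flow.

(** Shadowing: a coherent field of directions has a common target at infinity. *)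
Lemma coherent_field_target : exists2 x : nat -> G, cvg_infinity S x &
  forall h, exists N, forall M, (N <= M)%N -> L%:R - 7 * d <= gp h (x M) (v h).
Proof.
have [f [f0 f_step]] := flow_exists; exists f; first exact: flow_cvg_infinity.
exact: flow_shadows.
Qed.
End Shadowing.

(** * The coarse geometry and the topology of the boundary *)

Lemma ultra_finite_choice (T : Type) (F : set_system T) (A : eqType)
    (P : A -> set T) (s : seq A) : UltraFilter F ->
  F [set t | exists2 a, a \in s & P a t] -> exists2 a, a \in s & F (P a).
Proof.
move=> FU; elim: s => [|a s IH] Fs.
  have : F set0 by apply: filterS Fs => t [].
  by move/filter_not_empty.
have [FPa|FnPa] := in_ultra_setVsetC (P a) FU.
  by exists a => //; rewrite mem_head.
have [|b bs FPb] := IH; last by exists b => //; rewrite in_cons bs orbT.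
apply: filterS (filterI Fs FnPa) => t [[b]]; rewrite in_cons.
by case/orP=> [/eqP -> //|bs Pb _]; exists b.
Qed.

Section BoundaryFacts.
Variables (G : groupType) (S : genset G) (d : rat).
Hypothesis hypd : delta_hyperbolic S d.
Implicit Types (g h p : G) (x y z : nat -> G) (xi eta theta : boundary S).
Implicit Types r s : rat.
Notation wd := (word_dist S).
Notation gp := (gromov_prod S).
Notation near_seq := (gprod_eventually_ge S).

Lemma gprod_eventually_sym x y r : near_seq x y r -> near_seq y x r.
Proof.
by move=> [N xy]; exists N => i j Ni Nj; rewrite gromov_prod_sym; exact: xy.
Qed.

Lemma gprod_eventually_trans y x z r :
  near_seq x y r -> near_seq y z r -> near_seq x z (r - d).
Proof.
move=> [N xy] [M yz]; exists (maxn N M) => i j; rewrite !geq_max.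
move=> /andP[Ni Mi] /andP[Nj Mj].
by apply: (gromov_prod_trans hypd (h := y (maxn N M))); [apply: xy|apply: yz];
  rewrite ?leq_maxl ?leq_maxr.
Qed.

Lemma gprod_cvgy_sym x y : gprod_cvgy S x y -> gprod_cvgy S y x.
Proof. by move=> xy r; exact/gprod_eventually_sym. Qed.

Lemma gprod_cvgy_trans y x z :
  gprod_cvgy S x y -> gprod_cvgy S y z -> gprod_cvgy S x z.
Proof.
move=> xy yz r; have -> : r = (r + d) - d by lra.
exact: gprod_eventually_trans (xy _) (yz _).
Qed.

Lemma bclass_cvg_infinity xi x : bclass xi x -> cvg_infinity S x.
Proof. by have [z _ ->] := bclassP xi; case. Qed.

Lemma bclass_cvgy xi x y : bclass xi x -> bclass xi y -> gprod_cvgy S x y.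
Proof.
have [z _ ->] := bclassP xi => -[_ /gprod_cvgy_sym zx] [_].
exact: gprod_cvgy_trans.
Qed.

Lemma bclass_nonempty xi : exists x, bclass xi x.
Proof. by have [z cz ->] := bclassP xi; exists z; split. Qed.

Lemma bclass_of_cvg x : cvg_infinity S x -> exists xi, bclass xi x.
Proof.
move=> cx; have cP : exists2 z, cvg_infinity S z &
  boundary_class S x = boundary_class S z by exists x.
by exists (Boundary cP); split.
Qed.

Lemma boundary_eq xi eta x y :
  bclass xi x -> bclass eta y -> gprod_cvgy S x y -> xi = eta.
Proof.
move=> xix etay xy; apply: boundaryP; apply/seteqP.
have cvg (a b : boundary S) (s t : nat -> G) :
    bclass a s -> bclass b t -> gprod_cvgy S s t -> bclass a `<=` bclass b.
  move=> as_ bt st u au; have cu := bclass_cvg_infinity au.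
  have tu : gprod_cvgy S t u.
    exact: gprod_cvgy_trans (gprod_cvgy_sym st) (bclass_cvgy as_ au).
  move: bt; have [z _ ->] := bclassP b => -[_ zt]; split => //.
  exact: gprod_cvgy_trans zt tu.
by split; [apply: cvg xix etay xy | apply: cvg etay xix (gprod_cvgy_sym xy)].
Qed.

(** Membership in [boundary_nbhs] is witnessed by some representatives, but up to
    a bounded loss it can be tested on any of them. *)
Lemma boundary_nbhs_rep xi eta r x y : boundary_nbhs xi r eta ->
  bclass xi x -> bclass eta y -> near_seq x y (r - 2 * d).
Proof.
move=> [a [b [xia etab ab]]] xix etay; have [d0 _] := hypd.
have xa : near_seq x a r := bclass_cvgy xix xia r.
have by_ : near_seq b y r := bclass_cvgy etab etay r.
have -> : r - 2 * d = r - d - d by lra.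
apply: gprod_eventually_trans (gprod_eventually_trans xa ab) _.
by apply: gprod_eventually_le by_; lra.
Qed.

Lemma boundary_nbhs_le xi r s : s <= r -> boundary_nbhs xi r `<=` boundary_nbhs xi s.
Proof.
move=> sr eta [x [y [xix etay xy]]]; exists x, y; split=> //.
exact: gprod_eventually_le xy.
Qed.

Lemma boundary_nbhs_refl xi r : boundary_nbhs xi r xi.
Proof.
have [x xix] := bclass_nonempty xi; exists x, x; split=> //.
exact: bclass_cvg_infinity xix r.
Qed.

Lemma boundary_nbhs_sym xi eta r : boundary_nbhs xi r eta -> boundary_nbhs eta r xi.
Proof.
move=> [x [y [xix etay xy]]]; exists y, x; split=> //.
exact: gprod_eventually_sym.
Qed.

Lemma boundary_nbhs_trans eta xi theta r :
  boundary_nbhs xi r eta -> boundary_nbhs eta r theta ->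
  boundary_nbhs xi (r - 3 * d) theta.
Proof.
have [d0 _] := hypd.
move=> [x [y [xix etay xy]]] etatheta; have [z thetaz] := bclass_nonempty theta.
exists x, z; split=> //; have -> : r - 3 * d = r - 2 * d - d by lra.
apply: gprod_eventually_trans (boundary_nbhs_rep etatheta etay thetaz).
by apply: gprod_eventually_le xy; lra.
Qed.

Lemma boundary_nbhs_eq xi eta : (forall r, boundary_nbhs xi r eta) -> xi = eta.
Proof.
move=> xieta; have [x xix] := bclass_nonempty xi.
have [y etay] := bclass_nonempty eta; apply: (boundary_eq xix etay) => r.
have -> : r = r + 2 * d - 2 * d by lra.
exact: boundary_nbhs_rep.
Qed.

(** The sets [boundary_nbhs xi r] need not be open, but by coarse transitivity
    the points with a smaller neighbourhood inside a given set form an open set. *)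
Lemma nbhs_boundaryP xi (A : set (boundary S)) :
  nbhs xi A <-> exists r, boundary_nbhs xi r `<=` A.
Proof.
have [d0 _] := hypd; split.
  rewrite nbhsE => -[B [oB Bxi] BA]; have : boundary_open B by [].
  by move=> /(_ xi Bxi)[r rB]; exists r; apply: subset_trans BA.
move=> [r rA]; rewrite nbhsE /=.
exists [set eta | exists s, boundary_nbhs eta s `<=` A]; last first.
  by move=> eta [s]; apply; exact: boundary_nbhs_refl.
split; last by exists r.
suff : boundary_open [set eta | exists s, boundary_nbhs eta s `<=` A] by [].
move=> eta [s sA]; exists (s + 3 * d) => theta etatheta.
exists (s + 3 * d) => zeta thetazeta; apply: sA.
have -> : s = s + 3 * d - 3 * d by lra.
exact: boundary_nbhs_trans thetazeta.
Qed.

Lemma nbhs_boundary xi r : nbhs xi (boundary_nbhs xi r).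
Proof. by apply/nbhs_boundaryP; exists r. Qed.

(** A point at distance [n] on a quasi-ray from [1] to [xi]. *)
Lemma ray_point xi (n : nat) : exists p, wd 1%g p = n /\
  forall x, bclass xi x ->
    exists N, forall i, (N <= i)%N -> n%:R - 2 * d <= gp 1%g p (x i).
Proof.
have [x xix] := bclass_nonempty xi; have cx := bclass_cvg_infinity xix.
have [N xN] := cx n%:R.
have nxN : (n <= wd 1%g (x N))%N by rewrite -(ler_nat rat) -gromov_prod_self xN.
have [p [p1 px]] := word_dist_geodesic nxN; exists p; split=> // y xiy.
have [M xyM] := bclass_cvgy xix xiy n%:R.
exists (maxn N M) => i; rewrite geq_max => /andP[Ni Mi].
have pE : gp 1%g p (x N) = n%:R.
  have := px; move=> /(congr1 (fun n => n%:R : rat)).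
  rewrite natrB //.
  by rewrite /gromov_prod -(word_dist_sym S 1%g) p1 (word_dist_sym S (x N)); lra.
have xNM : n%:R <= gp 1%g (x N) (x (maxn N M)) by rewrite xN ?leq_maxl.
have xy : n%:R - d <= gp 1%g (x (maxn N M)) (y i).
  by have := xyM (maxn N M) i (leq_maxr _ _) Mi; have [d0 _] := hypd; lra.
have pxM : n%:R <= gp 1%g p (x N) by rewrite pE.
by have := gromov_prod_trans hypd (gromov_prod_trans hypd pxM xNM) xy; lra.
Qed.

(** Expansivity. The witness is [p^-1] for a point [p] far out on a ray to
    [xi]: seen from [p], the base point [1] is opposite to [xi]; if [eta] is
    roughly in the direction of [xi] seen from [p], then [1] is opposite to [eta]
    as well, so [1] sees [xi] and [eta] together at least up to [p]. *)
Lemma boundary_expansive xi r : exists p : G, forall eta,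
  boundary_nbhs (shift_boundary p xi) (6 * d) (shift_boundary p eta) ->
  boundary_nbhs xi r eta.
Proof.
have [d0 _] := hypd.
have [k /(_ k (leqnn k)) rk] := exists_natr_ge (r + 4 * d).
have [p [p1 p_ray]] := ray_point xi k.
have [x xix] := bclass_nonempty xi; have [N px_ge] := p_ray x xix.
exists p^-1%g => eta near_p; have [y etay] := bclass_nonempty eta.
have [M xyM] : near_seq (shift_seq p^-1%g x) (shift_seq p^-1%g y) (4 * d).
  have -> : 4 * d = 6 * d - 2 * d by lra.
  by apply: boundary_nbhs_rep near_p _ _; [exists x | exists y].
exists x, y; split=> //; exists (maxn N M) => i j; rewrite !geq_max.
move=> /andP[Ni Mi] /andP[Nj Mj].
have xy : 4 * d <= gp p (x i) (y j).
  rewrite -(gromov_prod_translate S p^-1%g) mulVg; exact: xyM.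
have x1 : gp p 1%g (x i) <= 2 * d.
  by have := px_ge i Ni; rewrite [gp p _ _]gromov_prod_swap (word_dist_sym S p) p1; lra.
have y1 : gp p 1%g (y j) <= 2 * d + d.
  by apply: (gromov_prod_bound hypd x1); rewrite gromov_prod_sym; lra.
have py_ge : k%:R - 3 * d <= gp 1%g p (y j).
  by rewrite [gp 1%g _ _]gromov_prod_swap p1; lra.
have xp_ge : k%:R - 3 * d <= gp 1%g (x i) p.
  by have := px_ge i Ni; rewrite gromov_prod_sym; lra.
by have := gromov_prod_trans hypd xp_ge py_ge; lra.
Qed.

Lemma ball_finite (n : nat) :
  exists s : seq G, forall g, (word_length S g <= n)%N -> g \in s.
Proof.
suff [s sP] : exists s : seq G, forall m g, (m <= n)%N -> word_of S m g -> g \in s.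
  by exists s => g gn; apply: sP gn (word_lengthP S g).
elim: n => [|n [s sP]].
  exists [:: 1%g] => -[|//] g _ [w [/size0nil -> _ ->]].
  by rewrite big_nil inE.
pose S1 := (S : seq G) ++ [seq c^-1%g | c <- (S : seq G)].
exists (1%g :: [seq (a * b)%g | a <- S1, b <- s]).
move=> m g mn [[|a w] [sw aw ->]]; first by rewrite big_nil inE eqxx.
rewrite big_cons in_cons; apply/orP; right; move: aw => /= /andP[aS wS].
apply: allpairs_f; last first.
  by apply: (sP (size w)); [rewrite -ltnS; move: sw mn => /= -> | exists w].
rewrite mem_cat; case/orP: aS => [->//|aS]; apply/orP; right.
by apply/mapP; exists a^-1%g; rewrite ?invgK.
Qed.

(** An ultrafilter selects, for each [n], one point [p n] of the finite sphere of
    radius [n] through which pass the rays to almost all boundary points; the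
    sequence [p] then converges to the limit of the ultrafilter. *)
Lemma boundary_compact : compact [set: boundary S].
Proof.
have [d0 _] := hypd.
rewrite compact_ultra => F FU _.
pose P n p xi := wd 1%g p = n /\ forall x, bclass xi x ->
    exists N, forall i, (N <= i)%N -> n%:R - 2 * d <= gp 1%g p (x i).
have /choice[p FP] : forall n, exists q, F (P n q).
  move=> n; have [s sP] := ball_finite n.
  have [|q _ Fq] := @ultra_finite_choice _ F _ (P n) s FU; last by exists q.
  apply: filterS filterT => xi _; have [q [q1 qP]] := ray_point xi n.
  exists q; last by split.
  by apply: sP; rewrite -q1 /word_dist invg1 mul1g.
have pp n m : (n <= m)%N -> n%:R - 3 * d <= gp 1%g (p n) (p m).
  move=> nm; have [xi [[_ nP] [_ mP]]] := filter_ex (filterI (FP n) (FP m)).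
  have [x xix] := bclass_nonempty xi.
  have [N xN] := nP x xix; have [M xM] := mP x xix.
  have nmR : n%:R <= m%:R :> rat by rewrite ler_nat.
  have := xN _ (leq_maxl N M); have := xM _ (leq_maxr N M).
  move: (x _) => t tm tn; have -> : n%:R - 3 * d = n%:R - 2 * d - d by lra.
  by apply: (gromov_prod_trans hypd (h := t)) => //; rewrite gromov_prod_sym; lra.
have cp : cvg_infinity S p.
  move=> r; have [N /(_ N (leqnn N)) rN] := exists_natr_ge (r + 5 * d).
  exists N => i j Ni Nj.
  have NiR : N%:R <= i%:R :> rat by rewrite ler_nat.
  have NjR : N%:R <= j%:R :> rat by rewrite ler_nat.
  have [ij|/ltnW ji] := leqP i j; first by have := pp _ _ ij; lra.
  by rewrite gromov_prod_sym; have := pp _ _ ji; lra.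
have [xi xip] := bclass_of_cvg cp; exists xi; split=> // A /nbhs_boundaryP[r rA].
have [n /(_ n (leqnn n)) rn] := exists_natr_ge (r + 5 * d).
apply: filterS (FP n) => eta [_ etaP]; apply: rA.
have [x etax] := bclass_nonempty eta; exists p, x; split=> //.
have [N xN] := etaP x etax; exists (maxn n N) => i j; rewrite !geq_max.
move=> /andP[ni _] /andP[_ Nj].
have pnx : n%:R - 3 * d <= gp 1%g (p n) (x j) by have := xN j Nj; lra.
have := pp _ _ ni; rewrite gromov_prod_sym => pin.
by have := gromov_prod_trans hypd pin pnx; lra.
Qed.

End BoundaryFacts.

(** * Uniform neighbourhoods in the compact-open topology *)

Section UniformNbhs.
Variables (G : groupType) (S : genset G) (d : rat).
Hypothesis hypd : delta_hyperbolic S d.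
Notation X := (boundary S).
Implicit Types (xi eta theta : X) (r : rat).

(** On the compact space [X], closeness at all points is a compact-open
    neighbourhood. The compact sets to use are closures of coarse balls, which by
    coarse transitivity lie in slightly larger coarse balls. *)
Lemma near_map_nbhs (f : {compact-open, X -> X}) r : continuous f ->
  nbhs f [set g : {compact-open, X -> X} | forall xi, boundary_nbhs (f xi) r (g xi)].
Proof.
move=> cf; have [d0 _] := hypd.
have /compact_near_coveringP cptX := boundary_compact hypd.
suff : \forall g \near nbhs f, [set: X] `<=` (fun xi => boundary_nbhs (f xi) r (g xi)).
  by apply: filterS => g gP xi; exact: gP.
apply: cptX => xi _; pose O := (boundary_nbhs (f xi) (r + 3 * d))°.
have /(cf xi) : nbhs (f xi) O by apply/nbhs_interior/(nbhs_boundary hypd).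
move=> /(nbhs_boundaryP hypd)[t tO]; pose K := closure (boundary_nbhs xi (t + 3 * d)).
have KO : f @` K `<=` O.
  move=> _ [eta Keta <-]; apply: tO.
  have [theta [xitheta etatheta]] := Keta _ (nbhs_boundary hypd eta (t + 3 * d)).
  have -> : t = t + 3 * d - 3 * d by lra.
  exact: (boundary_nbhs_trans hypd xitheta (boundary_nbhs_sym etatheta)).
have cptK : compact K.
  apply: subclosed_compact (boundary_compact hypd) _ => //; exact: closed_closure.
exists (boundary_nbhs xi (t + 3 * d),
  [set g : {compact-open, X -> X} | g @` K `<=` O]).
  split; first exact: (nbhs_boundary hypd).
  apply: open_nbhs_nbhs; split=> //; apply: compact_open_open => //.
  exact: open_interior.
move=> [eta g] /= [/subset_closure Keta gKO].
have /interior_subset feta : O (f eta) by apply: KO; exists eta.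
have /interior_subset geta : O (g eta) by apply: gKO; exists eta.
have -> : r = r + 3 * d - 3 * d by lra.
exact: (boundary_nbhs_trans hypd (boundary_nbhs_sym feta) geta).
Qed.

(** A Lebesgue number argument on each compact set of a subbasic open set. *)
Lemma nbhs_idfun_uniform (U : set (continuousType X X)) :
  nbhs (idfun : continuousType X X) U -> exists r, forall h : continuousType X X,
    (forall xi, boundary_nbhs xi r (h xi)) -> U h.
Proof.
have [d0 _] := hypd.
rewrite nbhsE => -[B [[A oA AB] Bid] BU].
have nA : nbhs (idfun : {compact-open, X -> X}) A.
  by apply: open_nbhs_nbhs; split=> //; move: Bid; rewrite -AB.
pose F := filter_from [set: nat] (fun n =>
  [set g : {compact-open, X -> X} | forall xi, boundary_nbhs xi n%:R (g xi)]).
have FF : Filter F.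
  apply: filter_from_filter; first by exists 0%N.
  move=> m n _ _; exists (maxn m n) => // g gmn.
  by split=> xi; apply: boundary_nbhs_le (gmn xi);
    rewrite ler_nat ?leq_maxl ?leq_maxr.
have [n _ nA'] : F A.
  suff : F --> (idfun : {compact-open, X -> X}) by apply.
  apply/compact_open_cvgP => K O /compact_near_coveringP cptK oO KO.
  have [|N _ NO] := cptK nat \oo (fun n xi => boundary_nbhs xi n%:R `<=` O) _.
    move=> xi Kxi; have /(nbhs_boundaryP hypd)[t tO] : nbhs xi O.
      by apply: open_nbhs_nbhs; split=> //; apply: KO; exists xi.
    have [b bP] := exists_natr_ge (t + 3 * d).
    exists (boundary_nbhs xi (t + 3 * d), [set n | (b <= n)%N]).
      by split; [exact: (nbhs_boundary hypd) | exists b].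
    move=> [eta n] /= [xieta tn] theta etatheta; apply: tO.
    have -> : t = t + 3 * d - 3 * d by lra.
    apply: (boundary_nbhs_trans hypd xieta).
    exact: boundary_nbhs_le (bP n tn) _ etatheta.
  exists N => // g gN _ [xi Kxi <-].
  by apply: (NO N (leqnn N) xi Kxi); exact: gN.
exists n%:R => h hn; apply: BU; rewrite -AB; exact: nA'.
Qed.

Lemma near_action_nbhs (rho0 : Hom_homeo G X) g r :
  nbhs rho0 [set rho : Hom_homeo G X |
    forall xi, boundary_nbhs (rho0 g xi) r (rho g xi)].
Proof.
have cev : continuous
    (fun rho : Hom_homeo G X => (rho g : X -> X) : {compact-open, X -> X}).
  move=> rho; apply: (@continuous_comp _ _ _
    (fun rho : Hom_homeo G X => rho g : homeo X)
    (fun f : homeo X => (f : X -> X) : {compact-open, X -> X})).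
    apply: (@continuous_comp _ _ _
      ((fun rho g => rho g) : Hom_homeo G X -> {ptws G -> homeo X})
      (fun f : {ptws G -> homeo X} => f g)).
      exact: initial_continuous.
    exact: proj_continuous.
  exact: initial_continuous.
exact: (cev rho0 _ (near_map_nbhs r (homeo_cts (h := rho0 g)))).
Qed.
End UniformNbhs.

(** * The semi-conjugacy *)

Lemma filter_forall_in (T : Type) (A : eqType) (F : set_system T)
    (P : A -> set T) (s : seq A) : Filter F ->
  (forall a, F (P a)) -> F [set t | forall a, a \in s -> P a t].
Proof.
move=> FF FP; elim: s => [|a s IH]; first by apply: filterS filterT.
apply: filterS (filterI (FP a) IH) => t [Pa Ps] b; rewrite in_cons.
by case/orP=> [/eqP ->|/Ps].
Qed.

Section SemiConjugacy.
Variables (G : groupType) (S : genset G) (d : rat) (L : nat).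
Hypothesis hypd : delta_hyperbolic S d.
(** With [20 d] two points shadowing the same orbit, or neighbouring points of it,
    stay [6 d]-close, as needed in [boundary_expansive]. *)
Hypothesis L_large : 20 * d <= L%:R.
Variable rho : Hom_homeo G (boundary S).
Hypothesis rho_near : forall g, (word_length S g <= L.*2)%N -> forall xi,
  boundary_nbhs (shift_boundary g xi) (L%:R + 4 * d) (rho g xi).
Notation wd := (word_dist S).
Notation gp := (gromov_prod S).
Implicit Types (xi eta : boundary S) (g h p : G).

Lemma homeo_morphM g h xi : rho (g * h)%g xi = rho g (rho h xi).
Proof. by rewrite gmulfM. Qed.

Lemma homeo_morph1 xi : rho 1%g xi = xi.
Proof.
(* [rho 1] is idempotent and injective. *)
by apply: (can_inj (homeo_funK (rho 1%g))); rewrite -homeo_morphM mulg1.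
Qed.

Definition shadows xi eta := forall g,
  boundary_nbhs (rho g xi) (L%:R - 8 * d) (shift_boundary g eta).

(** The field [v] approximates the directions [g (rho g^-1 xi)]: [p g] is far out
    on a ray to [rho g^-1 xi], and [v g] is its translate by [g]. For
    [s = h^-1 g] in the ball of radius [2 L], coherence of [v] between [g] and [h]
    is the closeness of [s] and [rho s] at [rho g^-1 xi]; the extra [4 d] in that
    closeness pays for passing from boundary points to elements of the group. *)
Lemma shadow_exists xi : exists eta, shadows xi eta.
Proof.
have [d0 _] := hypd; have Ld := L_large.
(* The distance [K] leaves room for a translation by [s], which costs [2 L]. *)
pose K := (4 * L)%N.
have KE : K%:R = 4 * L%:R :> rat by rewrite natrM.
have /choice[p pP] := fun g => ray_point hypd (rho g^-1%g xi) K.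
pose v g := (g * p g)%g.
have v_far g : (L <= wd g (v g))%N.
  have [p1 _] := pP g; rewrite /v -[X in wd X]mulg1 word_dist_mul p1 /K; lia.
have v_coherent g h : (wd g h <= L.*2)%N -> L%:R <= gp h (v g) (v h).
  move=> gh; pose s := (h^-1 * g)%g.
  have sL : (word_length S s <= L.*2)%N by rewrite -/(wd h g) word_dist_sym.
  have sLR : (word_length S s)%:R <= 2 * L%:R :> rat.
    by rewrite -natrM ler_nat mul2n.
  have [x gx] := bclass_nonempty (rho g^-1%g xi).
  have [y hy] := bclass_nonempty (rho h^-1%g xi).
  have [_ /(_ x gx)[N px]] := pP g; have [_ /(_ y hy)[M py]] := pP h.
  have := rho_near sL (rho g^-1%g xi).
  rewrite -homeo_morphM /s mulgK -/s => /(boundary_nbhs_rep hypd).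
  move=> /(_ (shift_seq s x) y) [|//|P sxy]; first by exists x.
  pose i := maxn P (maxn N M).
  have [Pi Ni Mi] : [/\ (P <= i)%N, (N <= i)%N & (M <= i)%N].
    by rewrite /i; split; lia.
  have := sxy i i Pi Pi; rewrite /shift_seq => {}sxy.
  have {}px := px i Ni; have {}py := py i Mi.
  have := gromov_prod_mul S s (p g) (x i) => spx.
  have -> : gp h (v g) (v h) = gp 1%g (s * p g)%g (p h).
    by rewrite -(gromov_prod_translate S h^-1%g) mulVg /v mulKg mulgA.
  have psx : L%:R + 2 * d <= gp 1%g (s * p g)%g (s * x i)%g by lra.
  have sxy' : L%:R + 2 * d <= gp 1%g (s * x i)%g (y i) by lra.
  have yp : L%:R + 2 * d - d <= gp 1%g (y i) (p h).
    by rewrite gromov_prod_sym; lra.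
  by have := gromov_prod_trans hypd (gromov_prod_trans hypd psx sxy') yp; lra.
have L13 : 13 * d <= L%:R by lra.
have [x cx xP] := coherent_field_target hypd L13 v_far v_coherent.
have [eta etax] := bclass_of_cvg cx; exists eta => g.
have [N xv] := xP g^-1%g; have [_ ] := pP g^-1%g; rewrite invgK => pP'.
have [y gy] := bclass_nonempty (rho g xi).
have [M py] := pP' y gy.
exists y, (shift_seq g x); split=> //; first by exists x.
exists (maxn N M) => i j; rewrite !geq_max => /andP[_ Mi] /andP[Nj _].
have := xv j Nj; have {}py := py i Mi.
rewrite /v -(gromov_prod_translate S g) mulgV mulVKg => gxp.
have -> : L%:R - 8 * d = L%:R - 7 * d - d by lra.
rewrite gromov_prod_sym; apply: gromov_prod_trans gxp _ => //.
lra.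
Qed.

Lemma shadow_unique xi eta eta' : shadows xi eta -> shadows xi eta' -> eta = eta'.
Proof.
have [d0 _] := hypd; have Ld := L_large.
move=> sh sh'; apply: (boundary_nbhs_eq hypd) => r.
have [p] := boundary_expansive hypd eta r; apply.
apply: boundary_nbhs_le
  (boundary_nbhs_trans hypd (boundary_nbhs_sym (sh p)) (sh' p)).
lra.
Qed.

Variable h : boundary S -> boundary S.
Hypothesis h_shadows : forall xi, shadows xi (h xi).

Lemma shadow_map_equivariant g xi : h (rho g xi) = shift_boundary g (h xi).
Proof.
apply: shadow_unique (h_shadows _) _ => k.
by rewrite -homeo_morphM shift_boundaryM; exact: h_shadows.
Qed.

Lemma shadow_map_near xi : boundary_nbhs xi (L%:R - 8 * d) (h xi).
Proof.
by have := h_shadows xi 1%g; rewrite homeo_morph1 shift_boundary1.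
Qed.

Lemma shadow_map_continuous : continuous h.
Proof.
have [d0 _] := hypd; have Ld := L_large.
move=> xi A /(nbhs_boundaryP hypd)[r rA].
have [p pP] := boundary_expansive hypd (h xi) r.
have nbhs_p : nbhs xi (rho p @^-1` boundary_nbhs (rho p xi) (L%:R - 8 * d)).
  exact: homeo_cts (nbhs_boundary hypd _ _).
apply: filterS nbhs_p => eta /= rho_p_eta; apply/rA/pP.
have := boundary_nbhs_trans hypd (boundary_nbhs_sym (h_shadows xi p)) rho_p_eta.
have lower : L%:R - 8 * d - 3 * d <= L%:R - 8 * d by lra.
move=> /(boundary_nbhs_trans hypd)/(_ (boundary_nbhs_le lower (h_shadows eta p))) near.
by apply: boundary_nbhs_le near; lra.
Qed.

(** [x n] is chosen so that [rho (p n)] takes it to [p n eta], which [h] moves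
    little; by equivariance [p n] takes [h (x n)] close to [p n eta], and
    expansivity of [p n] at [eta] gives [h (x n)] close to [eta]. *)
Lemma shadow_map_surjective eta : exists xi, h xi = eta.
Proof.
have [d0 _] := hypd; have Ld := L_large.
have /choice[p pP] := fun n : nat => boundary_expansive hypd eta n%:R.
pose x n := rho (p n)^-1%g (shift_boundary (p n) eta).
have hx n : boundary_nbhs eta n%:R (h (x n)).
  apply: pP; rewrite /x shadow_map_equivariant shift_boundaryM mulgV.
  rewrite shift_boundary1.
  by apply: boundary_nbhs_le (shadow_map_near _); lra.
have [xi [_ clxi]] := @boundary_compact _ _ _ hypd (x @ \oo) _ filterT.
exists xi; apply: (boundary_nbhs_eq hypd) => r.
have [k rk] := exists_natr_ge (r + 3 * d).
have large : (x @ \oo) (x @` [set n | (k <= n)%N]) by exists k => // n kn; exists n.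
have hxi := shadow_map_continuous (nbhs_boundary hypd (h xi) (r + 3 * d)).
have [_ [[n kn <-] hxn]] := clxi _ _ large hxi.
have -> : r = r + 3 * d - 3 * d by lra.
apply: (boundary_nbhs_trans hypd hxn).
exact: boundary_nbhs_le (rk n kn) _ (boundary_nbhs_sym (hx n)).
Qed.

End SemiConjugacy.

Theorem theorem1p1 (G : groupType) (S : genset G) (hypS : hyperbolic S)
    (U : set (continuousType (boundary S) (boundary S)))
    (nbhsU : nbhs (idfun : continuousType (boundary S) (boundary S)) U) :
  exists V : set (Hom_homeo G (boundary S)),
    nbhs (boundary_action S) V /\
    forall rho : Hom_homeo G (boundary S), V rho ->
      exists h : continuousType (boundary S) (boundary S),
        U h /\ semi_conjugacy (boundary_action S) rho h.
Proof.
(* Enlarging the hyperbolicity constant makes it positive. *)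
have [d hypd] : exists d, delta_hyperbolic S d.
  have [delta hyp] := hypS; exists (`|delta| + 1); split.
    by rewrite ltr_wpDl.
  move=> g h k o; apply: le_trans (hyp g h k o); rewrite lerD2l lerN2.
  by apply: le_trans (ler_norm _) _; rewrite lerDl.
have [d0 _] := hypd; have [r rU] := nbhs_idfun_uniform hypd nbhsU.
have [L /(_ L (leqnn L)) Lr] := exists_natr_ge (`|r| + 20 * d).
have r0 := normr_ge0 r; have rr := ler_norm r.
have [s sP] := ball_finite S L.*2.
exists [set rho : Hom_homeo G (boundary S) | forall g, g \in s -> forall xi,
  boundary_nbhs (shift_boundary g xi) (L%:R + 4 * d) (rho g xi)]; split.
  apply: filter_forall_in => g.
  exact: (near_action_nbhs hypd (boundary_action S)).
move=> rho rhoV; have L20 : 20 * d <= L%:R by lra.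
have rho_near g (gL : (word_length S g <= L.*2)%N) := rhoV g (sP g gL).
have /choice[h hP] := shadow_exists hypd L20 rho_near.
have hc := shadow_map_continuous hypd L20 hP.
exists (mkcts hc); split.
  apply: rU => xi; apply: boundary_nbhs_le (shadow_map_near hP xi); lra.
split=> // [eta|g]; first exact: (shadow_map_surjective hypd L20 hP).
by apply/funext => xi; exact: (shadow_map_equivariant hypd L20 hP).
Qed.
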